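(* Let $X$ be a compact metric space and let $F:X\to 2^X$ be upper semi-continuous. If there exists an infinite set $A\subseteq X$ such that $F(a)\supseteq A$ for all $a\in A$, then $h(F)=\infty$.
   Context: $\mathbb{N}=\{1,2,\ldots\}$. For a compact metric space $X$ with metric $d$, $2^X$ is the set of non-empty compact subsets of $X$. $F:X\to 2^X$ is upper semi-continuous if for every $x\in X$ and every open $V\subseteq X$ containing $F(x)$ there is an open $U\ni x$ with $F(t)\subseteq V$ for all $t\in U$. Entropy: for $n\in\mathbb{N}$, $\mathrm{Orb}_n(X,F)$ is the set of $n$-orbits, i.e. finite sequences $(x_0,\ldots,x_{n-1})$ in $X$ with $x_{i+1}\in F(x_i)$ for $0\le i\le n-2$, with the metric $D(\mathbf{x},\mathbf{y})=\max_{0\le i\le n-1}d(x_i,y_i)$. A subset of a metric space is $\epsilon$-separated if any two of its distinct points are at distance $\ge\epsilon$. $s_{n,\epsilon}(F)$ is the largest cardinality of an $\epsilon$-separated subset of $(\mathrm{Orb}_n(X,F),D)$, and the topological entropy of $F$ is $h(F)=\lim_{\epsilon\to0}\limsup_{n\to\infty}\frac1n\log s_{n,\epsilon}(F)\in[0,\infty]$. *)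

(* Defs.v *)
From HB Require Import structures.
From mathcomp Require Import all_boot all_order all_algebra.
From mathcomp Require Import all_classical all_reals all_analysis.
Import Order.TTheory GRing.Theory Num.Theory.
Import numFieldNormedType.Exports.

Set Implicit Arguments.
Unset Strict Implicit.
Unset Printing Implicit Defensive.

Local Open Scope classical_set_scope.
Local Open Scope ring_scope.

(* 2^X *)
Definition hyperspace (X : topologicalType) : set (set X) :=
  [set K | K !=set0 /\ compact K].
Arguments hyperspace : clear implicits.

Definition upper_semicontinuous (X : topologicalType) (F : X -> set X) : Prop :=
  forall (x : X) (V : set X), open V -> F x `<=` V ->
    exists U : set X, [/\ open U, U x & forall t, U t -> F t `<=` V].

Section entropy.
Variables (R : realType) (X : metricType R) (F : X -> set X).

Definition orbits (n : nat) : set (n.-tuple X) :=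
  [set x | forall i j : 'I_n, j = i.+1 :> nat -> F (tnth x i) (tnth x j)].

Definition orbit_dist (n : nat) (x y : n.-tuple X) : R :=
  \big[Num.max/0]_(i < n) mdist (tnth x i) (tnth y i).

Definition separated_orbits (n : nat) (e : R) (S : set (n.-tuple X)) : Prop :=
  forall x y, S x -> S y -> x <> y -> e <= orbit_dist x y.

(* s_{n,e}(F) as a supremum in \bar R over the finite e-separated sets. When X
   is compact and 0 < e, (X^n, orbit_dist) is totally bounded, so every
   e-separated set is finite and this supremum is a maximum. *)
Definition separation_number (n : nat) (e : R) : \bar R :=
  ereal_sup [set (k%:R)%:E | k in [set k : nat |
    exists S : set (n.-tuple X),
      [/\ S `<=` @orbits n, separated_orbits e S & (S #= `I_k)%card]]].

(* The term n = 0 is a junk value that the upper limit ignores. The upper limit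
   is nonincreasing in e, so the limit as e tends to 0 from the right exists. *)
Definition entropy : \bar R :=
  lim ((fun e : R => limn_esup (fun n : nat =>
    ((n%:R^-1)%:E * lne (separation_number n e))%E)) @ 0^'+).

End entropy.

Arguments orbits {R X} F n.
Arguments separation_number {R X} F n e.
Arguments entropy {R X} F.

(* Main.v *)
Require Import Defs.
From HB Require Import structures.
From mathcomp Require Import all_boot all_order all_algebra.
From mathcomp Require Import all_classical all_reals all_analysis.
Import Order.TTheory GRing.Theory Num.Theory.
Import numFieldNormedType.Exports.

Local Open Scope classical_set_scope.
Local Open Scope ring_scope.

(** The set [A] is a full shift inside the orbit space: every finite sequence of
    points of [A] is an orbit, since [F a] contains [A] for each [a] in [A].
    Choose [m] distinct points of [A].  Once [e] is at most their least mutual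
    distance, two distinct [n]-words over these points are [e]-apart (look at a
    letter where they differ), so the [m ^ n] words show that the separation
    number is at least [m ^ n] ([separation_number_ge_words]), and the growth
    rate at scale [e] is at least [ln m] ([growth_rate_ge_ln]).  This holds for
    all small [e], and [m] is arbitrary because [A] is infinite; hence the growth
    rate tends to [+oo] as [e] tends to [0]. *)

Lemma card_eq_setT_finType (T : finType) : ([set: T] #= `I_#|T|)%card.
Proof.
have rank_inj : {in [set: T] &, injective (fun t : T => enum_rank t : nat)}.
  by move=> x y _ _ /= /val_inj/enum_rank_inj.
have <- : (fun t : T => enum_rank t : nat) @` [set: T] = `I_#|T|.
  apply/seteqP; split=> [_ [t _ <-]|k /= k_lt] /=; first exact: ltn_ord.
  by exists (enum_val (Ordinal k_lt)) => //; rewrite enum_valK.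
exact/card_esym/inj_card_eq.
Qed.

Lemma infinite_set_injection {T : Type} {A : set T} : infinite_set A ->
  exists2 f : nat -> T, injective f & forall k, A (f k).
Proof.
move=> /infiniteP/card_leP[g].
exists (fun k => set_val (g (SigSub (mem_set (I : [set: nat] k))))).
  move=> i j /val_inj gij.
  by have /(congr1 set_val) := inj (in_setT _) (in_setT _) gij.
by move=> k; apply: set_valP.
Qed.

Lemma le_limn_esup {R : realType} (u : (\bar R)^nat) (c : \bar R) :
  (\forall n \near \oo, (c <= u n)%E) -> (c <= limn_esup u)%E.
Proof.
move=> cu; rewrite limn_esup_lim; apply: lime_ge; first exact: is_cvg_esups.
apply: filterS cu => n cun; apply: (le_trans cun).
by apply: ereal_sup_ubound; exists n => /=.
Qed.

Section words.
Context {R : realType} {X : metricType R} (F : X -> set X).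
Context {I : finType} (f : I -> X) {e : R}.
Hypothesis e_gt0 : 0 < e.
Hypothesis F_full : forall i j, F (f i) (f j).
Hypothesis f_sep : forall i j, i != j -> e <= mdist (f i) (f j).

Let f_inj : injective f.
Proof.
move=> i j fij; apply/eqP; apply: contraTT e_gt0 => /f_sep.
by rewrite fij mdistxx leNgt.
Qed.

(** Two words that differ at place [k] are at distance at least that of their
    [k]-th letters.  Positivity of [e] makes [f] injective, so that different
    words spell different orbits. *)
Lemma separation_number_ge_words n :
  ((#|I| ^ n)%:R%:E <= separation_number F n e)%E.
Proof.
apply: ereal_sup_ubound; exists (#|I| ^ n)%N => //=.
exists (map_tuple f @` [set: n.-tuple I]); split.
- by move=> _ [w _ <-] i j _; rewrite !tnth_map.
- move=> _ _ [v _ <-] [w _ <-] vw.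
  have [i vwi] : exists i, tnth v i != tnth w i.
    apply/existsP; apply: contra_notT vw => /existsPn vw.
    by congr map_tuple; apply: eq_from_tnth => i; apply/eqP/negPn.
  by apply: (bigmax_sup i) => //; rewrite !tnth_map f_sep.
- rewrite -card_tuple; apply: card_eq_trans (card_eq_setT_finType _).
  apply: inj_card_eq => v w _ _ /(congr1 val) /= /(inj_map f_inj).
  exact: val_inj.
Qed.

Lemma growth_rate_ge_ln : (0 < #|I|)%N ->
  ((ln #|I|%:R)%:E <= limn_esup (fun n : nat =>
     (n%:R^-1)%:E * lne (separation_number F n e)))%E.
Proof.
move=> I_gt0; apply: le_limn_esup; near=> n.
have n_gt0 : (0 < n)%N by near: n; exact: nbhs_infty_gt.
have words_gt0 : (0 : R) < (#|I| ^ n)%:R by rewrite ltr0n expn_gt0 I_gt0.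
have -> : (ln #|I|%:R)%:E = ((n%:R^-1)%:E * lne ((#|I| ^ n)%:R%:E) :> \bar R)%E.
  rewrite lne_EFin// natrX lnXn ?ltr0n// -EFinM -[ln _ *+ n]mulr_natl mulKf//.
  by rewrite pnatr_eq0 -lt0n.
apply: lee_wpmul2l; first by rewrite lee_fin invr_ge0.
have words_le := separation_number_ge_words n.
rewrite lee_lne// in_itv/= leey andbT; last apply: (le_trans _ words_le).
all: by rewrite lee_fin ltW.
Unshelve. all: by end_near. Qed.

End words.

Theorem theorem7p1 (R : realType) (X : metricType R) (F : X -> set X)
    (cptX : compact [set: X])
    (F2X : forall x : X, hyperspace X (F x))
    (uscF : upper_semicontinuous F)
    (exA : exists A : set X, infinite_set A /\ (forall a : X, A a -> A `<=` F a)) :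
  entropy F = +oo%E.
Proof.
have [A [A_inf AF]] := exA.
have [f f_inj Af] := infinite_set_injection A_inf.
apply: cvg_lim => //; apply/cvgeyPge => M.
(* With more than [exp M] points, the growth rate at small scales exceeds [M]. *)
pose m := (Num.truncn (expR M)).+1.
have M_le : M <= ln m%:R.
  rewrite -ler_expR lnK ?posrE ?ltr0n//; exact/ltW/truncnS_gt.
have f_sep : \forall e \near (0 : R)^'+,
    forall ij : 'I_m * 'I_m, ij.1 != ij.2 -> e <= mdist (f ij.1) (f ij.2).
  apply: filter_forall => -[i j] /=.
  have [ij|ij] := eqVneq i j; first exact: filterE.
  have : 0 < mdist (f i) (f j).
    by rewrite mdist_gt0; apply: contra_neq ij => /f_inj/val_inj.
  by move=> /nbhs_right_le; apply: filterS.
near=> e.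
apply: (@le_trans _ _ (ln m%:R)%:E); first by rewrite lee_fin.
rewrite -[m in X in (X <= _)%E]card_ord.
apply: (growth_rate_ge_ln F (fun i : 'I_m => f i)).
- by near: e; exact: nbhs_right_gt.
- by move=> i j; apply: AF.
- move=> i j; suff /(_ (i, j)) : forall ij : 'I_m * 'I_m,
      ij.1 != ij.2 -> e <= mdist (f ij.1) (f ij.2) by [].
  by near: e.
- by rewrite card_ord.
Unshelve. all: by end_near. Qed.
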